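(* Let $\Theta_0,\Theta_1\subset\Lambda$, and consider testing $H_0: P\in\Theta_0$ versus $H_1: P\in\Theta_1$. (i) Let $\tau_\Psi$ be any one of the weak topology, the $\tau$-topology, or the $\tau_\Phi$-topology on $\Lambda$, and let $\Theta_0$ be relatively compact in the $\tau_\Psi$-topology. If the closures of $\Theta_0$ and $\Theta_1$ in the $\tau_\Psi$-topology are disjoint, then $H_0$ and $H_1$ are distinguishable. (ii) If $\Theta_0$ and $\Theta_1$ are relatively compact in the $\tau$-topology, then the converse holds: if $H_0$ and $H_1$ are distinguishable, then the closures of $\Theta_0$ and $\Theta_1$ in the $\tau$-topology are disjoint.
   Context: $\Omega$ is a topological space with Borel $\sigma$-field $\mathfrak{B}$, and $\Lambda$ is the set of all probability measures on $(\Omega,\mathfrak{B})$. One observes i.i.d. random variables $X_1,\ldots,X_n$ with values in $\Omega$ and distribution $P\in\Lambda$. A test $K_n$ is a measurable function of $(X_1,\ldots,X_n)$ with values in $[0,1]$ (the probability of rejecting the hypothesis). Put $\alpha(K_n)=\sup_{P\in\Theta_0}E_P[K_n]$ and $\beta(K_n)=\sup_{P\in\Theta_1}E_P[1-K_n]$. $H_0$ and $H_1$ are distinguishable if there is a sequence of tests $K_n$ with $\lim_{n\to\infty}\alpha(K_n)=0$ and $\lim_{n\to\infty}\beta(K_n)=0$. For a set $\Psi$ of measurable functions $f:\Omega\to\mathbb{R}$, the $\tau_\Psi$-topology on $\Lambda$ is the coarsest topology for which all maps $P\mapsto\int_\Omega f\,dP$, $f\in\Psi$, are continuous. If $\Psi$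 is the set of all bounded continuous functions this is the weak topology; if $\Psi$ is the set of indicator functions of all Borel sets it is the $\tau$-topology; if $\Psi=\Phi$ is the set of all bounded measurable functions it is the $\tau_\Phi$-topology. *)

(* Defs.v *)
From HB Require Import structures.
From mathcomp Require Import all_boot all_order all_algebra.
From mathcomp Require Import all_classical all_reals all_analysis.

Set Implicit Arguments.
Unset Strict Implicit.
Unset Printing Implicit Defensive.
Import Order.TTheory GRing.Theory Num.Theory.
Import numFieldNormedType.Exports.

Local Open Scope classical_set_scope.
Local Open Scope ring_scope.

(* A [measurableType] carries a point, hence [ptopologicalType]; this costs no
   generality, since an empty space carries no probability measure. *)
Notation borel Omega := (g_sigma_algebraType (@open Omega)).
Notation Lambda R Omega := (probability (borel Omega) R).

Section product_law.
Context d (T : measurableType d) (R : realType).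

Definition cons_tuple n (x : T * n.-tuple T) : n.+1.-tuple T :=
  [the n.+1.-tuple T of x.1 :: x.2].

Lemma measurable_cons_tuple n : measurable_fun setT (@cons_tuple n).
Proof. exact: measurable_cons. Qed.

HB.instance Definition _ n :=
  isMeasurableFun.Build _ _ _ _ (@cons_tuple n) (@measurable_cons_tuple n).

(* The law of (X_1, ..., X_n) when the X_i are i.i.d. with law P, that is, the
   n-fold product measure; see [iid_lawE]. *)
Fixpoint iid_law (P : probability T R) n : probability (n.-tuple T) R :=
  match n with
  | 0 => \d_([tuple])
  | n.+1 => distribution (P \x iid_law P n)%E (@cons_tuple n)
  end.

Lemma iid_lawE (P : probability T R) n (A : 'I_n -> set T) :
  (forall i, measurable (A i)) ->
  iid_law P n [set x | forall i, A i (tnth x i)] = (\prod_(i < n) P (A i))%E.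
Proof.
elim: n A => [|n IH] A mA.
  rewrite big_ord0 /= diracE mem_set//=; by case.
rewrite big_ord_recl -IH//= /distribution /pushforward /=.
rewrite -product_measure1E//; last first.
  rewrite (_ : [set _ | _] =
      \bigcap_(i in [set: 'I_n]) ((@tnth _ T ^~ i) @^-1` A (lift ord0 i))).
    apply: fin_bigcap_measurable => [|i _]; first exact: finite_finset.
    rewrite -[X in measurable X]setTI.
    exact: measurable_tnth.
  by apply/seteqP; split => [x h i _|x h i]; exact: h.
congr (_ _); apply/seteqP; split => -[x t] /=.
  move=> h; split; first exact: (h ord0).
  by move=> i; have := h (lift ord0 i); rewrite tnthS.
by move=> [hx ht] i; case: (unliftP ord0 i) => [j|] ->//; rewrite tnthS.
Qed.

End product_law.

Section tau_topology.
Context (R : realType) (Omega : ptopologicalType).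
Implicit Types Psi : set (Omega -> R).

(* [Lambda R Omega] with the coarsest topology making P |-> \int f dP
   continuous for all f in Psi. *)
Definition tau_space Psi : topologicalType :=
  sup_topology (fun f : {f | Psi f} => Topological.on
    (initial_topology (fun P : Lambda R Omega => \int[P]_x (sval f) x))).

Definition tau_closure Psi (Theta : set (Lambda R Omega)) :
  set (Lambda R Omega) := @closure (tau_space Psi) Theta.

Definition tau_relatively_compact Psi (Theta : set (Lambda R Omega)) : Prop :=
  @compact (tau_space Psi) (tau_closure Psi Theta).

Definition bounded_continuous : set (Omega -> R) :=
  [set f | continuous f /\ bounded_fun f].

Definition borel_indicators : set (Omega -> R) :=
  [set \1_A | A in (measurable : set (set (borel Omega)))].

Definition bounded_borel : set (Omega -> R) :=
  [set f | measurable_fun setT (f : borel Omega -> R) /\ bounded_fun f].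

End tau_topology.
Arguments bounded_continuous : clear implicits.
Arguments borel_indicators : clear implicits.
Arguments bounded_borel : clear implicits.

Section tests.
Context (R : realType) (Omega : ptopologicalType).
Implicit Types Theta : set (Lambda R Omega).

Definition is_test n (K : n.-tuple (borel Omega) -> R) : Prop :=
  measurable_fun setT K /\ forall x, 0 <= K x <= 1.

(* The suprema are those of [R], so that the error over an empty hypothesis
   is 0, as for the supremum of the empty subset of [0, 1]. *)
Definition type1_error Theta n (K : n.-tuple (borel Omega) -> R) : R :=
  sup [set fine 'E_(iid_law P n)[K] | P in Theta].

Definition type2_error Theta n (K : n.-tuple (borel Omega) -> R) : R :=
  sup [set fine 'E_(iid_law P n)[fun x => 1 - K x] | P in Theta].

Definition distinguishable Theta0 Theta1 : Prop :=
  exists2 K : forall n, n.-tuple (borel Omega) -> R,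
    forall n, is_test (K n) &
    type1_error Theta0 (K n) @[n --> \oo] --> 0 /\
    type2_error Theta1 (K n) @[n --> \oo] --> 0.

End tests.

(* Main.v *)
Require Import Defs.
From mathcomp Require Import all_boot all_order all_algebra.
From mathcomp Require Import all_classical all_reals all_analysis.
From mathcomp Require Import measurable_realfun ring lra.

Set Implicit Arguments.
Unset Strict Implicit.
Unset Printing Implicit Defensive.
Import Order.TTheory GRing.Theory Num.Theory.
Import numFieldNormedType.Exports.

Local Open Scope classical_set_scope.
Local Open Scope ring_scope.

(** Two hypotheses are called separable below when some sequence of tests has
    errors tending to 0 uniformly on each of them; this is distinguishability
    with the suprema spelled out.

    Part (i). For fixed [A], the sets [B] that are separable from [A] form an
    ideal: the maximum of two tests separates [A] from the union of the two
    alternatives. Exchanging a test with its complement shows that separability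
    is symmetric, so the same holds in the other argument. Hence only one
    concrete pair has to be tested, [\int f <= a] against [b <= \int f] with [f]
    bounded and [a < b] ([separable_mean]). The test there is a product
    [g(x_1) * ... * g(x_n)] truncated at 1, as its expectation is the [n]-th
    power of [\int g], and [g] can be chosen so that [\int g] is uniformly less
    than 1 on one side and [\int 1 / g] on the other.
    Every subbasic neighborhood of [P] is defined by one mean, so the ideal
    property lets every neighborhood [N] of [P] contain a smaller one that is
    separable from the complement of [N] ([separable_nbhs]). The ideal property
    once more and compactness then pass from points of the closure of the first
    hypothesis to the whole of it ([separable_closure]).

    Part (ii). By Dini's theorem the members of a compact set [C] for the
    [tau]-topology are uniformly continuous at the empty set: if events [A_k]
    decrease to the empty set, then [Q(A_k)] tends to 0 uniformly in [Q \in C]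
    ([compact_equicontinuous]). This property passes to [n]-fold products
    ([equicontinuous_iid]). It makes the events [A] for which [Q |-> Q^n(A)] is
    continuous on [C] closed under increasing unions; they contain the
    rectangles, so they are all the events ([setwise_cvg_iid]).
    For a test with small errors let [A] be the event that it exceeds 1 / 2. By
    Markov's inequality [Q^n(A)] is at most 1 / 4 on one hypothesis and at least
    3 / 4 on the other, and by continuity both bounds extend to the closures,
    which therefore have no common point. *)

(** * Expectations of functions with values in the unit interval *)

Section unit_functions.
Local Open Scope ereal_scope.
Context d (T : measurableType d) (R : realType).
Implicit Types (P : probability T R) (K L : T -> R).

Definition unit_fun K := measurable_fun setT K /\ forall x, (0 <= K x <= 1)%R.

Lemma unit_fun_cst (c : R) : (0 <= c <= 1)%R -> unit_fun (cst c).
Proof. by move=> c01; split. Qed.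

Lemma unit_funC K : unit_fun K -> unit_fun (fun x => 1 - K x)%R.
Proof.
move=> [mK K01]; split; first exact: measurable_funB.
by move=> x; have := K01 x; lra.
Qed.

Lemma unit_fun_max K L :
  unit_fun K -> unit_fun L -> unit_fun (fun x => Num.max (K x) (L x)).
Proof.
move=> [mK K01] [mL L01]; split; first exact: measurable_maxr.
by move=> x; rewrite maxEle; case: ifP.
Qed.

Lemma le_expectation P K L :
  measurable_fun setT K -> (forall x, 0 <= K x)%R ->
  measurable_fun setT L -> (forall x, K x <= L x)%R -> 'E_P[K] <= 'E_P[L].
Proof.
move=> mK K0 mL KL; apply: expectation_le => //.
- by move=> x; exact: le_trans (KL x).
- exact: aeW.
Qed.

Lemma unit_fun_expectation P K : unit_fun K -> 0 <= 'E_P[K] <= 1.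
Proof.
move=> [mK K01]; apply/andP; split.
  by apply: expectation_ge0 => x; case/andP: (K01 x).
rewrite -(expectation_cst P 1); apply: le_expectation => //.
- by move=> x; case/andP: (K01 x).
- by move=> x; case/andP: (K01 x).
Qed.

Lemma unit_fun_expectationE P K : unit_fun K ->
  'E_P[K] = (fine 'E_P[K])%:E.
Proof.
move=> /(unit_fun_expectation P)/andP[E0 E1]; rewrite fineK//.
by rewrite ge0_fin_numE// (le_lt_trans E1)// ltry.
Qed.

Lemma ge0_expectationD P K L :
  measurable_fun setT K -> (forall x, 0 <= K x)%R ->
  measurable_fun setT L -> (forall x, 0 <= L x)%R ->
  'E_P[fun x => (K x + L x)%R] = 'E_P[K] + 'E_P[L].
Proof.
move=> mK K0 mL L0; rewrite unlock.
under eq_integral do rewrite EFinD.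
by rewrite ge0_integralD//; try exact/measurable_EFinP;
  move=> x _; rewrite lee_fin.
Qed.

End unit_functions.

(** * Separable hypotheses *)

Section uniform_consistency.
Local Open Scope ereal_scope.
Context d (T : measurableType d) (R : realType).
Implicit Types (A B : set (probability T R)) (K : forall n, n.-tuple T -> R).

Definition consistent A B K := forall e : R, (0 < e)%R ->
  \forall n \near \oo,
    (forall P, A P -> 'E_(iid_law P n)[K n] <= e%:E) /\
    (forall P, B P -> 'E_(iid_law P n)[fun x => (1 - K n x)%R] <= e%:E).

Definition separable A B :=
  exists2 K : forall n, n.-tuple T -> R,
    (forall n, unit_fun (K n)) & consistent A B K.

Lemma separable_sub A A' B B' :
  A' `<=` A -> B' `<=` B -> separable A B -> separable A' B'.
Proof.
move=> AA BB [K K01 cK]; exists K => // e /cK; apply: filterS => n [cA cB].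
by split => P; [move/AA/cA|move/BB/cB].
Qed.

Lemma separableC A B : separable A B -> separable B A.
Proof.
move=> [K K01 cK]; exists (fun n x => (1 - K n x)%R).
  by move=> n; exact: unit_funC.
move=> e /cK; apply: filterS => n [cA cB]; split; first exact: cB.
move=> P /cA; rewrite (_ : (fun x => _) = K n)//.
by apply/funext => x; rewrite opprB addrCA subrr addr0.
Qed.

Lemma separable0 A : separable set0 A.
Proof.
exists (fun n => cst 1%R) => [n|e e0]; first by apply: unit_fun_cst; lra.
near=> n; split => // P _.
rewrite [X in 'E_ _ [X]](_ : _ = cst 0%R); last first.
  by apply/funext => x /=; rewrite subrr.
by rewrite expectation_cst lee_fin ltW.
Unshelve. all: by end_near. Qed.

(** The larger of the two tests rejects whenever one of them does, so its error
    on [A] is at most the sum of both errors there. *)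
Lemma separableUr A B B' :
  separable A B -> separable A B' -> separable A (B `|` B').
Proof.
move=> [K K01 cK] [L L01 cL]; exists (fun n x => Num.max (K n x) (L n x)).
  by move=> n; exact: unit_fun_max.
move=> e e0; have e20 : (0 < e / 2)%R by lra.
have := cK _ e20; have := cL _ e20; apply: filterS2 => n [LA LB] [KA KB].
have [mM M01] := unit_fun_max (K01 n) (L01 n).
have [[mK K1] [mL L1]] := (K01 n, L01 n).
split=> [P AP|P [BP|BP]].
- apply: (@le_trans _ _ ('E_(iid_law P n)[fun x => K n x + L n x]%R)).
    apply: le_expectation => //; first by move=> x; case/andP: (M01 x).
    + exact: measurable_funD.
    + by move=> x; rewrite ge_max; have := K1 x; have := L1 x; lra.
  rewrite ge0_expectationD//; first last.
  + by move=> x; case/andP: (L1 x).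
  + by move=> x; case/andP: (K1 x).
  by rewrite [e]splitr EFinD leeD ?KA ?LA.
- apply: le_trans (le_trans (KB _ BP) _); last by rewrite lee_fin; lra.
  apply: le_expectation => //;
    [exact: measurable_funB| |exact: measurable_funB|].
  + by move=> x; case/andP: (M01 x); rewrite subr_ge0.
  + by move=> x; rewrite lerD2l lerN2 le_max lexx.
- apply: le_trans (le_trans (LB _ BP) _); last by rewrite lee_fin; lra.
  apply: le_expectation => //;
    [exact: measurable_funB| |exact: measurable_funB|].
  + by move=> x; case/andP: (M01 x); rewrite subr_ge0.
  + by move=> x; rewrite lerD2l lerN2 le_max lexx orbT.
Qed.

Lemma separableUl A A' B :
  separable A B -> separable A' B -> separable (A `|` A') B.
Proof.
by move=> /separableC AB /separableC A'B; apply/separableC/separableUr.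
Qed.

End uniform_consistency.

Section distinguishable_separable.
Context (R : realType) (Omega : ptopologicalType).
Implicit Types Theta : set (Lambda R Omega).

Lemma sup_le_ge0 (E : set R) (e : R) : 0 <= e -> ubound E e -> sup E <= e.
Proof.
move=> e0 Ee; have [->|E0] := eqVneq E set0; first by rewrite sup0.
by apply: ge_sup => //; exact/set0P.
Qed.

(** The bound [0 <= e] covers the empty hypothesis, whose supremum is 0. The
    absolute value puts the left side in the form used for convergence to 0. *)
Lemma sup_error_le Theta n (K : n.-tuple (borel Omega) -> R) e :
  unit_fun K -> 0 <= e ->
  `|sup [set fine 'E_(iid_law P n)[K] | P in Theta]| <= e <->
  (forall P, Theta P -> ('E_(iid_law P n)[K] <= e%:E)%E).
Proof.
move=> uK e0; set E := [set _ | _ in _].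
have E01 x : E x -> 0 <= x <= 1.
  move=> [P _ <-]; have := unit_fun_expectation (iid_law P n) uK.
  by rewrite [in X in X -> _](unit_fun_expectationE _ uK) !lee_fin.
have E_ub : has_ubound E by exists 1 => x /E01/andP[].
split=> [Ee P TP|Ee].
  rewrite (unit_fun_expectationE _ uK) lee_fin.
  apply: le_trans (le_trans (ler_norm _) Ee).
  by apply: ub_le_sup => //; exists P.
have sE : sup E <= e.
  apply: sup_le_ge0 => // _ [P TP <-].
  have := Ee P TP.
  by rewrite [in X in X -> _](unit_fun_expectationE _ uK) lee_fin.
rewrite ger0_norm//.
have [->|/set0P[x Ex]] := eqVneq E set0; first by rewrite sup0.
by have /andP[x0 _] := E01 _ Ex; apply: le_trans x0 (ub_le_sup _ Ex).
Qed.

Lemma distinguishableE Theta0 Theta1 :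
  distinguishable Theta0 Theta1 <-> separable Theta0 Theta1.
Proof.
split=> -[K K01].
  move=> [/cvgr0Pnorm_le K0 /cvgr0Pnorm_le K1]; exists K => // e e0.
  move: (K0 _ e0) (K1 _ e0); apply: filterS2 => n.
  move=> /sup_error_le H0 /sup_error_le H1; split.
    exact: H0 (K01 n) (ltW e0).
  exact: H1 (unit_funC (K01 n)) (ltW e0).
move=> cK; exists K => //; split.
  apply/cvgr0Pnorm_le => e e0; move: (cK _ e0); apply: filterS => n [H _].
  by apply/sup_error_le => //; exact: ltW.
apply/cvgr0Pnorm_le => e e0; move: (cK _ e0); apply: filterS => n [_ H].
by apply/sup_error_le => //; [exact: unit_funC|exact: ltW].
Qed.

End distinguishable_separable.

(** * Product tests for the mean of a bounded function *)

Section likelihood_tests.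
Local Open Scope ereal_scope.
Context d (T : measurableType d) (R : realType).
Implicit Types (P : probability T R) (g : T -> R).

Lemma measurable_fun_inv_gt0 g : measurable_fun setT g ->
  (forall x, 0 < g x)%R -> measurable_fun setT (fun x => (g x)^-1)%R.
Proof.
move=> mg g0.
have mV : measurable_fun (`]0%R, +oo[%classic : set R) (@GRing.inv R).
  apply: open_continuous_measurable_fun; first exact: interval_open.
  move=> x; rewrite inE/= in_itv/= andbT => x0.
  by apply: inv_continuous; rewrite gt_eqF.
apply: measurable_comp mV mg => //.
by move=> _ [x _ <-]; rewrite /= in_itv/= g0.
Qed.

Lemma le_expe (x y : \bar R) n : 0 <= x -> x <= y -> x ^+ n <= y ^+ n.
Proof.
move=> x0 xy; elim: n => [|n IH]; first by rewrite !expe0.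
by rewrite !expeS lee_pmul// expe_ge0.
Qed.

Definition iid_prod g n (x : n.-tuple T) : R := (\prod_(i < n) g (tnth x i))%R.

Lemma measurable_iid_prod g n :
  measurable_fun setT g -> measurable_fun setT (@iid_prod g n).
Proof.
move=> mg; apply: measurable_prod => i _.
by apply: measurableT_comp => //; exact: measurable_tnth.
Qed.

Lemma iid_prod_ge0 g n (x : n.-tuple T) :
  (forall x, 0 <= g x)%R -> (0 <= iid_prod g x)%R.
Proof. by move=> g0; exact: prodr_ge0. Qed.

Lemma iid_prodV g n (x : n.-tuple T) :
  iid_prod (fun x => (g x)^-1)%R x = (iid_prod g x)^-1%R.
Proof. by rewrite /iid_prod prodfV. Qed.

(** Tonelli's theorem, one coordinate at a time. *)
Lemma expectation_iid_prod P g n :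
  measurable_fun setT g -> (forall x, 0 <= g x)%R ->
  'E_(iid_law P n)[@iid_prod g n] = 'E_P[g] ^+ n.
Proof.
move=> mg g0; elim: n => [|n IH].
  rewrite expe0 unlock /= integral_dirac//; last first.
    by apply/measurable_EFinP; exact: measurable_iid_prod.
  by rewrite diracT mul1e /iid_prod big_ord0.
rewrite expeS -IH unlock /=.
rewrite ge0_integral_distribution//=; first last.
  by move=> y; rewrite lee_fin; exact: iid_prod_ge0.
  by apply/measurable_EFinP; exact: measurable_iid_prod.
rewrite fubini_tonelli1//=; first last.
- by move=> y; rewrite lee_fin; exact: iid_prod_ge0.
- apply/measurable_EFinP; apply: measurableT_comp => //.
  exact: measurable_iid_prod.
rewrite /fubini_F -ge0_integralZr//; first last.
- by apply: integral_ge0 => y _; rewrite lee_fin; exact: iid_prod_ge0.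
- by move=> y _; rewrite lee_fin.
- exact/measurable_EFinP.
apply: eq_integral => x _; rewrite -ge0_integralZl//; first last.
- by rewrite lee_fin.
- by move=> y _; rewrite lee_fin; exact: iid_prod_ge0.
- by apply/measurable_EFinP; exact: measurable_iid_prod.
apply: eq_integral => y _ /=.
rewrite /iid_prod big_ord_recl -EFinM; congr (_ * _)%:E.
by apply: eq_bigr => i _; rewrite tnthS.
Qed.

(** The test is the product of the [g(x_i)] truncated at 1. It is at most the
    product, and its distance to 1 is at most the product of the inverses: if
    the product is less than 1 then its inverse exceeds 1, and otherwise that
    distance is 0. Both products have expectation at most [r ^ n]. *)
Lemma separable_ratio (A B : set (probability T R)) g (r : R) :
  measurable_fun setT g -> (forall x, 0 < g x)%R -> (0 <= r < 1)%R ->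
  (forall P, A P -> 'E_P[g] <= r%:E) ->
  (forall P, B P -> 'E_P[fun x => (g x)^-1%R] <= r%:E) ->
  separable A B.
Proof.
move=> mg g_gt0 /andP[r0 r1] Ag Bg.
have g0 x : (0 <= g x)%R by exact: ltW.
have mV : measurable_fun setT (fun x => (g x)^-1%R).
  exact: measurable_fun_inv_gt0.
pose K n x := Num.min (@iid_prod g n x) 1%R.
have mK n : measurable_fun setT (K n).
  by apply: measurable_minr => //; exact: measurable_iid_prod.
have K01 n x : (0 <= K n x <= 1)%R.
  by rewrite /K ge_min lexx orbT andbT le_min ler01 iid_prod_ge0.
have le_rn P (h : T -> R) n : measurable_fun setT h -> (forall x, 0 <= h x)%R ->
    'E_P[h] <= r%:E -> 'E_(iid_law P n)[@iid_prod h n] <= (r ^+ n)%:E.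
  move=> mh h0 hr; rewrite expectation_iid_prod// EFin_expe.
  by apply: le_expe => //; exact: expectation_ge0.
exists K; first by move=> n; split; [exact: mK|exact: K01].
move=> e e0.
have : ((fun n => r ^+ n) @ \oo --> 0)%R.
  by apply: cvg_expr; rewrite ger0_norm.
move=> /cvgr0Pnorm_le/(_ e e0).
apply: filterS => n; rewrite ger0_norm ?exprn_ge0// => rne.
split=> P.
  move=> /Ag/(le_rn _ _ n mg g0)/le_trans; rewrite -lee_fin in rne.
  move/(_ _ rne); apply: le_trans.
  apply: le_expectation; [exact: mK| |exact: measurable_iid_prod|].
    by move=> x; case/andP: (K01 n x).
  by move=> x; rewrite /K ge_min lexx.
have V0 x : (0 <= (g x)^-1)%R by rewrite invr_ge0.
move=> /Bg/(le_rn _ _ n mV V0)/le_trans; rewrite -lee_fin in rne.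
move/(_ _ rne); apply: le_trans.
apply: le_expectation; [| |exact: measurable_iid_prod|].
- by apply: measurable_funB => //; exact: mK.
- by move=> x; have := K01 n x; lra.
move=> x; rewrite iid_prodV /K minEle; case: ifPn => [p1|_].
  have p0 : (0 < iid_prod g x)%R by exact: prodr_gt0.
  by rewrite (@le_trans _ _ 1%R)// ?invf_ge1//; lra.
by rewrite subrr invr_ge0 iid_prod_ge0.
Qed.

Lemma bounded_integrable P g :
  measurable_fun setT g -> bounded_fun g -> P.-integrable setT (EFin \o g).
Proof.
move=> mg bg; apply: measurable_bounded_integrable => //.
by rewrite -ge0_fin_numE// fin_num_measure.
Qed.

Lemma expectation_affine P g (p q : R) :
  measurable_fun setT g -> bounded_fun g ->
  'E_P[fun x => (p + q * g x)%R] = (p + q * \int[P]_x g x)%:E.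
Proof.
move=> mg bg; have ig := bounded_integrable P mg bg.
have fin_g := integrable_fin_num measurableT ig.
rewrite unlock; under eq_integral do rewrite EFinD EFinM.
rewrite integralD//; first last.
- exact: integrableZl.
- by apply: finite_measure_integrable_cst.
rewrite integral_cst//= probability_setT mule1 integralZl//.
by rewrite EFinD EFinM fineK.
Qed.

(** With [m] halfway between [a] and [b], and [c] the distance from [m] to
    either, the function [g = 1 + t * (f - m)] has mean at most [1 - t * c] when
    [f] has mean at most [a]. Its inverse is [1 - t * (f - m)] up to a term of
    order [t ^ 2], hence has mean at most [1 - t * c / 2] when [f] has mean at
    least [b] and [t] is small. *)
Lemma separable_mean (f : T -> R) (a b : R) :
  measurable_fun setT f -> bounded_fun f -> (a < b)%R ->
  separable [set P : probability T R | \int[P]_x f x <= a]%R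
            [set P : probability T R | b <= \int[P]_x f x]%R.
Proof.
move=> mf bf ab; pose m := ((a + b) / 2)%R; pose c := ((b - a) / 2)%R.
have c0 : (0 < c)%R by rewrite /c; lra.
have [M M0 fM] := ex_strict_bound_gt0 bf.
pose D := (M + `|m| + c)%R.
have D0 : (0 < D)%R by rewrite /D; have := normr_ge0 m; lra.
have fD x : (`|f x - m| <= D)%R.
  apply: le_trans (ler_normB _ _) _; rewrite /D.
  have : (`|f x| < M)%R by exact: fM.
  lra.
have cD : (c <= D)%R by rewrite /D; have := normr_ge0 m; lra.
(* This [t] makes [|t * (f - m)| <= 1 / 4], so that [g >= 1 / 2], and keeps the
   quadratic error [2 * (t * (f - m)) ^ 2] at most [t * c / 2]. *)
pose t := (c / (4 * D ^+ 2))%R.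
have t0 : (0 < t)%R by rewrite divr_gt0// mulr_gt0// exprn_gt0.
have tDD : (t * D ^+ 2 = c / 4)%R.
  by rewrite /t; field; rewrite gt_eqF.
have tD : (t * D <= 1 / 4)%R.
  rewrite -(ler_pM2r D0) -mulrA -expr2 tDD; lra.
have tc : (t * c <= 1 / 4)%R.
  by apply: le_trans tD; rewrite ler_pM2l.
pose g x := (1 - t * m + t * f x)%R.
have gE x : g x = (1 + t * (f x - m))%R by rewrite /g; ring.
have g12 x : (1 / 2 <= g x)%R.
  have : (`|t * (f x - m)| <= 1 / 4)%R.
    by rewrite normrM gtr0_norm//; apply: le_trans tD; rewrite ler_pM2l.
  by rewrite gE ler_norml; lra.
have mg : measurable_fun setT g.
  by apply: measurable_funD => //; exact: measurable_funM.
apply: (@separable_ratio _ _ g (1 - t * c / 2)) => //.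
- by move=> x; have := g12 x; lra.
- have : (0 < t * c)%R by rewrite mulr_gt0.
  lra.
- move=> P /= Pa; rewrite expectation_affine// lee_fin.
  have : (t * \int[P]_x f x <= t * a)%R by rewrite ler_pM2l.
  have : (t * a = t * m - t * c)%R by rewrite /m /c; field.
  have : (0 < t * c)%R by rewrite mulr_gt0.
  lra.
- move=> P /= Pb.
  apply: (@le_trans _ _ 'E_P[fun x => (1 + t * c / 2 + t * m) + - t * f x]%R).
    apply: le_expectation => //.
    + by apply: measurable_fun_inv_gt0 => // x; have := g12 x; lra.
    + by move=> x; rewrite invr_ge0; have := g12 x; lra.
    + by apply: measurable_funD => //; exact: measurable_funM.
    (* 1 / (1 + y) <= 1 - y + 2 * y ^ 2 for y >= - 1 / 2 *)
    + move=> x; have gx := g12 x.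
      have gx0 : (0 < g x)%R by lra.
      rewrite -(ler_pM2l gx0) divff ?gt_eqF//.
      have : (t ^+ 2 * (f x - m) ^+ 2 <= t * c / 4)%R.
        rewrite -mulrA -tDD expr2 -mulrA ler_pM2l// ler_pM2l//.
        by rewrite -[leLHS]ger0_norm ?sqr_ge0// normrX lerXn2r// ?nnegrE// ltW.
      rewrite gE in gx *; set y := (f x - m)%R in gx *.
      rewrite (_ : 1 + t * c / 2 + t * m + - t * f x =
                   1 - t * y + t * c / 2)%R; last by rewrite /y; ring.
      rewrite -exprMn; nra.
  rewrite expectation_affine// lee_fin mulNr.
  have : (t * b <= t * \int[P]_x f x)%R by rewrite ler_pM2l.
  have : (t * b = t * m + t * c)%R by rewrite /m /c; field.
  lra.
Qed.

End likelihood_tests.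

(** * Separation in a topology generated by means *)

Section topology_separation.
Context (R : realType) (Omega : ptopologicalType).
Implicit Types (Psi : set (Omega -> R)) (P : Lambda R Omega).

Definition mean (f : Omega -> R) (P : Lambda R Omega) : R := \int[P]_x f x.

Lemma continuous_tau Psi f : Psi f ->
  continuous (mean f : tau_space Psi -> R).
Proof.
move=> Pf P.
have h := (@cvg_sup _ _ _ (nbhs (P : tau_space Psi)) P (nbhs_filter _)).1
  (fun A PA => PA) (exist _ f Pf).
apply: cvg_trans (@initial_continuous _ _ (mean f) P).
exact: cvg_app h.
Qed.

Lemma cvg_tau Psi (F : set_system (Lambda R Omega)) P : Filter F ->
  (forall f, Psi f -> mean f @ F --> mean f P) ->
  F --> (P : tau_space Psi).
Proof.
move=> FF h; apply/cvg_sup => -[f Pf] A /=.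
rewrite (@nbhsE (initial_topology _)) => -[B [[C oC <-] BP] BA].
apply: filterS BA _; apply: h Pf _ _; exact: open_nbhs_nbhs.
Qed.

(** The sets [N] with this property form a filter because separability is
    stable under unions in its second argument, so it is enough that the filter
    converges to [P]. This concerns a single mean, for which the complement of
    [N] consists of two half-spaces. *)
Lemma separable_nbhs Psi P (N : set (Lambda R Omega)) :
  Psi `<=` bounded_borel R Omega ->
  nbhs (P : tau_space Psi) N ->
  exists2 U, nbhs (P : tau_space Psi) U &
    separable (U : set (Lambda R Omega)) (~` N).
Proof.
move=> bPsi.
pose F : set_system (Lambda R Omega) := [set N : set (Lambda R Omega) |
  exists2 U, nbhs (P : tau_space Psi) U &
    separable (U : set (Lambda R Omega)) (~` N)].
have FF : Filter F.
  split.
  - exists setT; first exact: filterT.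
    by rewrite setCT; apply: separableC; exact: separable0.
  - move=> M N' [U PU UM] [V PV VN]; exists (U `&` V); first exact: filterI.
    rewrite setCI; apply: separableUr.
    + by apply: separable_sub UM.
    + by apply: separable_sub VN.
  - move=> M N' MN [U PU UM]; exists U => //; apply: separable_sub UM => //.
    exact: subsetC.
suff: F --> (P : tau_space Psi) by exact.
apply: cvg_tau => f Pf; have [mf bf] := bPsi _ Pf.
apply/cvgrPdist_lt => e e0.
exists [set Q : Lambda R Omega | `|mean f P - mean f Q| < e / 2].
  have := @continuous_tau _ _ Pf P.
  by move=> /cvgrPdist_lt; apply; lra.
have e20 : mean f P + e / 2 < mean f P + e by lra.
have e21 : mean f P - e < mean f P - e / 2 by lra.
apply: (@separable_sub _ _ _ _ _
  ([set Q : Lambda R Omega | mean f P + e <= mean f Q] `|`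
   [set Q : Lambda R Omega | mean f Q <= mean f P - e]) _ (fun _ h => h)).
  move=> Q /= /negP; rewrite -leNgt ler_normr; lra.
apply: separableUr.
  apply: separable_sub (separable_mean mf bf e20) => Q //=.
  by rewrite ltr_norml => /andP[+ _]; rewrite /mean; lra.
apply: separableC; apply: separable_sub (separable_mean mf bf e21) => Q //=.
by rewrite ltr_norml => /andP[_]; rewrite /mean; lra.
Qed.

(** If the closure [C] were not separable from [Theta1], the sets [N] such that
    [C] minus [N] is separable from [Theta1] would form a proper filter. A
    cluster point in [C] has a neighborhood separable from [Theta1], whose
    complement belongs to the filter although it misses that neighborhood. *)
Lemma separable_closure Psi (Theta0 Theta1 : set (Lambda R Omega)) :
  Psi `<=` bounded_borel R Omega ->
  tau_relatively_compact Psi Theta0 ->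
  tau_closure Psi Theta0 `&` tau_closure Psi Theta1 = set0 ->
  separable Theta0 Theta1.
Proof.
move=> bPsi cTheta0 disj.
set C : set (Lambda R Omega) := tau_closure Psi Theta0.
suff : separable C Theta1.
  by apply: separable_sub => //; exact: (@subset_closure (tau_space Psi)).
apply: contrapT => nC.
pose F : set_system (Lambda R Omega) :=
  [set N : set (Lambda R Omega) | separable (~` N `&` C) Theta1].
have FF : ProperFilter F.
  split.
    by rewrite /F /= setC0 setTI.
  split.
  - by rewrite /F /= setCT set0I; exact: separable0.
  - by move=> M N FM FN; rewrite /F/= setCI setIUl; exact: separableUl.
  - move=> M N MN; apply: separable_sub => //; apply: setSI; exact: subsetC.
have FC : F C by rewrite /F /= setICl; exact: separable0.
have [P [CP PF]] := cTheta0 F FF FC.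
have : ~ tau_closure Psi Theta1 P.
  by move=> C1P; have : set0 P by rewrite -disj.
move=> /existsNP[N /not_implyP[PN TN]].
have [U PU UN] := separable_nbhs bPsi PN.
have FU : F (~` U).
  rewrite /F/= setCK; apply: separable_sub UN.
  by move=> Q [].
  by move=> Q TQ NQ; apply: TN; exists Q.
have [Q []] := PF _ _ FU PU.
exact.
Qed.

Lemma continuous_borel (f : Omega -> R) :
  continuous f -> measurable_fun setT (f : borel Omega -> R).
Proof.
move=> /continuousP cf; apply: (measurability _ (RGenOpens.measurableE R)).
move=> _ [_ [a [b ->] <-]]; rewrite setTI; apply: sub_sigma_algebra.
exact/cf/interval_open.
Qed.

Lemma bounded_continuous_borel :
  bounded_continuous R Omega `<=` bounded_borel R Omega.
Proof. by move=> f [cf bf]; split => //; exact: continuous_borel. Qed.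

Lemma borel_indicators_borel :
  borel_indicators R Omega `<=` bounded_borel R Omega.
Proof.
move=> _ [A mA <-]; split; first exact: measurable_indic.
exists 1; split => // x x1 t _; rewrite /= ger0_norm// indicE.
by apply: le_trans (ltW x1); case: (_ \in _).
Qed.

End topology_separation.

(** * Uniform continuity at the empty set *)

Section uniform_continuity_at_empty.
Local Open Scope ereal_scope.
Context (R : realType) (I : Type) (C : set I).

(** Continuity at the empty set amounts to countable additivity; this is its
    uniform version for the family of the [mu i] with [i] in [C]. *)
Definition equicontinuous_at_set0 d (T : measurableType d)
    (mu : I -> probability T R) :=
  forall A : nat -> set T, (forall k, measurable (A k)) ->
    (forall m n, (m <= n)%N -> A n `<=` A m) -> \bigcap_k A k = set0 ->
  forall e : R, (0 < e)%R -> exists k, forall i, C i -> mu i (A k) < e%:E.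

(** If the events [A_k] violate the conclusion, choose for every [k] an index
    [s k] at which the product gives [A_k] mass at least [e]. Only countably
    many measures are then involved, so the set [B_k] of the [x] whose section
    of [A_k] has mass at least [e / 2] for one of them is measurable. The [B_k]
    decrease to the empty set by the hypothesis on [nu]; by that on [mu] some
    [B_k] has mass less than [e / 2] under every [mu i] with [i] in [C], and
    Fubini's theorem contradicts the choice of [s k]. *)
Lemma equicontinuous_prod d1 d2 (T1 : measurableType d1)
    (T2 : measurableType d2) (mu : I -> probability T1 R)
    (nu : I -> probability T2 R) :
  equicontinuous_at_set0 mu -> equicontinuous_at_set0 nu ->
  equicontinuous_at_set0
    (fun i => (mu i \x nu i) : probability (T1 * T2)%type R).
Proof.
move=> mu0 nu0 A mA dA A0 e e0; apply: contrapT => nA.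
have e20 : (0 < e / 2)%R by lra.
have {nA}/choice[s sA] :
    forall k, exists i, C i /\ e%:E <= (mu i \x nu i) (A k).
  move=> k; apply: contrapT => nk; apply: nA; exists k => i Ci.
  by rewrite ltNge; apply/negP => h; apply: nk; exists i.
pose B k := \bigcup_j [set x | (e / 2)%:E <= nu (s j) (xsection (A k) x)].
have mB k : measurable (B k).
  apply: bigcupT_measurable => j; rewrite -[X in measurable X]setTI.
  apply: emeasurable_fun_c_infty => //.
  exact: measurable_fun_xsection.
have dB m n : (m <= n)%N -> B n `<=` B m.
  move=> mn x [j _ /= jx]; exists j => //=; apply: le_trans jx _.
  apply: le_measure; rewrite ?inE; try exact: measurable_xsection.
  exact/le_xsection/dA.
have B0 : \bigcap_k B k = set0.
  apply/seteqP; split => // x Bx.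
  have [|||k nuk] := nu0 (fun k => xsection (A k) x) _ _ _ _ e20.
  + by move=> k; exact: measurable_xsection.
  + by move=> m n mn; exact/le_xsection/dA.
  + apply/seteqP; split => // y Ay.
    suff : (\bigcap_k A k) (x, y) by rewrite A0.
    by move=> k _; have := Ay k Logic.I; rewrite xsectionE.
  have [j _ /=] := Bx k Logic.I.
  by rewrite leNgt => /negP; apply; apply: nuk; exact: (sA j).1.
have [k muB] := mu0 B mB dB B0 _ e20.
have [Ck] := sA k; apply/negP; rewrite -ltNge.
rewrite /product_measure1 /=.
have fB : measurable_fun setT (EFin \o \1_(B k) : T1 -> \bar R).
  by apply/measurable_EFinP; exact: measurable_indic.
apply: (@le_lt_trans _ _
    (\int[mu (s k)]_x ((\1_(B k) x)%:E + (e / 2)%:E))).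
  apply: ge0_le_integral => //.
  - exact: measurable_fun_xsection.
  - by apply: emeasurable_funD.
  - move=> x _ /=; rewrite indicE.
    have [xB|xB] := pselect (B k x).
      rewrite mem_set//=; apply: (@le_trans _ _ 1).
        exact/probability_le1/measurable_xsection.
      by rewrite leeDl// lee_fin ltW.
    rewrite memNset//= add0e leNgt; apply/negP => h; apply: xB.
    by exists k => //=; exact: ltW.
rewrite ge0_integralD//; last by move=> x _; rewrite lee_fin ltW.
rewrite integral_indic// setIT integral_cst//= probability_setT mule1.
by rewrite [e in ltRHS]splitr EFinD lte_leD// muB.
Qed.

Lemma equicontinuous_iid d (T : measurableType d) (mu : I -> probability T R)
    n :
  equicontinuous_at_set0 mu ->
  equicontinuous_at_set0 (fun i => iid_law (mu i) n).
Proof.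
move=> mu0; elim: n => [|n IH] A mA dA A0 e e0.
  have [k Ak] : exists k, ~ A k [tuple].
    apply/existsNP => A1.
    by have : (\bigcap_k A k) [tuple] by []; rewrite A0.
  by exists k => i _; rewrite /= diracE memNset.
pose B k := @Defs.cons_tuple _ T n @^-1` A k.
have mB k : measurable (B k).
  by rewrite -[X in measurable X]setTI; exact: Defs.measurable_cons_tuple.
have dB m k : (m <= k)%N -> B k `<=` B m by move=> mk x; exact: dA.
have B0 : \bigcap_k B k = set0.
  apply/seteqP; split => // x Bx.
  by suff : (\bigcap_k A k) (Defs.cons_tuple x) by rewrite A0.
exact: (equicontinuous_prod mu0 IH mB dB B0 e0).
Qed.

End uniform_continuity_at_empty.

(** * Setwise convergence of product laws *)

Section setwise_convergence.
Context (R : realType) (I : Type) (C : set I) (F : set_system I).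
Context {FF : Filter F} (i0 : I) (FC : F C) (Ci0 : C i0).

Definition setwise_cvg d (T : measurableType d) (mu : I -> probability T R) :=
  forall A, measurable A -> fine (mu i A) @[i --> F] --> fine (mu i0 A).

Lemma fine_measureD d (T : measurableType d) (P : probability T R)
    (A B : set T) :
  measurable A -> measurable B -> B `<=` A ->
  fine (P (A `\` B)) = fine (P A) - fine (P B).
Proof.
move=> mA mB BA; rewrite measureD//; last first.
  by rewrite -ge0_fin_numE// fin_num_measure.
by rewrite setIidr// fineB// fin_num_measure.
Qed.

(** Along an increasing sequence the limits in [i] and in the sequence may be
    interchanged, as uniform continuity at the empty set makes the convergence
    along the sequence uniform in [i]. So the events at which there is
    convergence form a lambda-system. *)
Lemma setwise_cvg_generated d (T : measurableType d) (G : set (set T))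
    (mu : I -> probability T R) :
  (measurable : set (set T)) = <<s G>> -> setI_closed G ->
  equicontinuous_at_set0 C mu ->
  (forall A, G A -> fine (mu i A) @[i --> F] --> fine (mu i0 A)) ->
  setwise_cvg mu.
Proof.
move=> GE GI mu0 Gcvg.
pose H := [set A | measurable A /\ fine (mu i A) @[i --> F] --> fine (mu i0 A)].
suff : <<s G>> `<=` H by move=> GH A; rewrite GE => /GH[].
apply: lambda_system_subset => //; last first.
  by move=> A GA; split; [rewrite GE; exact: sub_sigma_algebra|exact: Gcvg].
split => //.
- split => //; under eq_fun do rewrite probability_setT.
  by rewrite probability_setT; exact: cvg_cst.
- move=> A B AB [mA cA] [mB cB]; split; first exact: measurableD.
  rewrite fine_measureD//; under eq_fun do rewrite fine_measureD//.
  exact: cvgB.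
move=> A ndA HA.
have mA k : measurable (A k) by have [] := HA k.
have mU : measurable (\bigcup_k A k) by exact: bigcupT_measurable.
split => //.
have AU k : A k `<=` \bigcup_k A k by move=> x Ax; exists k.
have fineU (P : probability T R) k : fine (P (\bigcup_k A k)) = fine (P (A k)) +
    fine (P (\bigcup_k A k `\` A k)).
  by rewrite fine_measureD// addrC subrK.
pose D k := \bigcup_k A k `\` A k.
have mD k : measurable (D k) by exact: measurableD.
have dD m n : (m <= n)%N -> D n `<=` D m.
  by move=> mn; apply: setDS; move/ndA: mn => /subsetPset.
have D0 : \bigcap_k D k = set0.
  apply/seteqP; split => // x Dx; have [[k _ Akx] _] := Dx 0%N Logic.I.
  by have [_] := Dx k Logic.I.
apply/cvgrPdist_lt => e e0; have e30 : 0 < e / 3 by lra.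
have [k muk] := mu0 D mD dD D0 _ e30.
have {}muk i : C i -> 0 <= fine (mu i (D k)) < e / 3.
  move=> /muk; rewrite -[X in (X < _)%E -> _]fineK ?fin_num_measure//.
  rewrite lte_fin => ->.
  by rewrite andbT fine_ge0.
have /cvgrPdist_lt/(_ _ e30) := (HA k).2.
apply: filterS2 FC => i /muk; have := muk _ Ci0.
rewrite !(fineU _ k) -/(D k) !ltr_norml; lra.
Qed.

Lemma setwise_cvg_prod d1 d2 (T1 : measurableType d1)
    (T2 : measurableType d2) (mu : I -> probability T1 R)
    (nu : I -> probability T2 R) :
  equicontinuous_at_set0 C mu -> equicontinuous_at_set0 C nu ->
  setwise_cvg mu -> setwise_cvg nu ->
  setwise_cvg (fun i => (mu i \x nu i)%E : probability (T1 * T2)%type R).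
Proof.
move=> mu0 nu0 muc nuc.
apply: (setwise_cvg_generated (measurable_prod_measurableType T1 T2)).
- move=> _ _ [A1 mA1 [B1 mB1 <-]] [A2 mA2 [B2 mB2 <-]].
  by rewrite -setXI; exists (A1 `&` A2); [exact: measurableI|];
    exists (B1 `&` B2) => //; exact: measurableI.
- exact: equicontinuous_prod.
move=> _ [A mA [B mB <-]].
have E i : fine (mu i A) * fine (nu i B) = fine ((mu i \x nu i)%E (A `*` B)).
  by rewrite product_measure1E// fineM ?fin_num_measure.
have := cvgM (muc A mA) (nuc B mB); rewrite E (eq_cvg F _ E); exact.
Qed.

Lemma setwise_cvg_iid d (T : measurableType d) (mu : I -> probability T R) n :
  equicontinuous_at_set0 C mu -> setwise_cvg mu ->
  setwise_cvg (fun i => iid_law (mu i) n).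
Proof.
move=> mu0 muc; elim: n => [|n IH] A mA; first exact: cvg_cst.
have mcA : measurable (@Defs.cons_tuple _ T n @^-1` A).
  by rewrite -[X in measurable X]setTI; exact: Defs.measurable_cons_tuple.
exact: (setwise_cvg_prod mu0 (equicontinuous_iid (n := n) mu0) muc IH mcA).
Qed.

End setwise_convergence.

(** * Compact sets for the topology of setwise convergence *)

Section tau_compactness.
Context (R : realType) (Omega : ptopologicalType).
Implicit Types (Theta : set (Lambda R Omega)) (P : Lambda R Omega).
Local Notation inds := (borel_indicators R Omega).

Lemma mean_indic (A : set (borel Omega)) P : measurable A ->
  mean \1_A P = fine (P A).
Proof. by move=> mA; rewrite /mean /Rintegral integral_indic// setIT. Qed.

Lemma continuous_measure (A : set (borel Omega)) : measurable A ->
  continuous (fun P : tau_space inds => fine ((P : Lambda R Omega) A)).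
Proof.
move=> mA; rewrite (_ : (fun _ => _) = (mean \1_A : tau_space inds -> R)).
  by apply: continuous_tau; exists A.
by apply/funext => P; rewrite mean_indic.
Qed.

(** Dini's theorem for the functions [Q |-> Q(A_k)], which are continuous and
    decrease to 0 on [K]. *)
Lemma compact_equicontinuous (K : set (tau_space inds)) : compact K ->
  equicontinuous_at_set0 (K : set (Lambda R Omega)) id.
Proof.
move=> cK A mA dA A0 e e0; apply: contrapT => nA.
have {nA}/choice[s sA] :
    forall k, exists P : Lambda R Omega, K P /\ (e%:E <= P (A k))%E.
  move=> k; apply: contrapT => nk; apply: nA; exists k => P KP.
  by rewrite ltNge; apply/negP => h; apply: nk; exists P.
have [P [KP Ps]] : K `&` cluster ((s : nat -> tau_space inds) @ \oo) !=set0.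
  by apply: cK; exists 0%N => // k _; exact: (sA k).1.
have : (P : Lambda R Omega) \o A @ \oo --> (P : Lambda R Omega) (\bigcap_k A k).
  apply: nonincreasing_cvg_mu => //.
  - by rewrite -ge0_fin_numE// fin_num_measure.
  - exact: bigcapT_measurable.
  - by move=> m n mn; apply/subsetPset; exact: dA.
rewrite A0 measure0 => /fine_cvgP[_ PA0].
have [k _ /(_ k (leqnn k))/= PAk] := cvgr_lt _ PA0 _ e0.
have Uk : nbhs P
    [set Q : tau_space inds | fine ((Q : Lambda R Omega) (A k)) < e].
  exact: (cvgr_lt _ (@continuous_measure _ (mA k) P) _ PAk).
have Tk : ((s : nat -> tau_space inds) @ \oo)
    [set s j | j in [set j | (k <= j)%N]].
  by exists k => // j /= kj; exists j.
have [_ [[j kj <-] /=]] := Ps _ _ Tk Uk.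
apply/negP; rewrite -leNgt -lee_fin fineK ?fin_num_measure//.
apply: le_trans (sA j).2 _; apply: le_measure; rewrite ?inE//; exact: dA.
Qed.

(** Continuity of [Q |-> Q^n(A)] is known only on the compact closure of
    [Theta], so the neighborhoods of [P] are restricted to that closure. *)
Lemma iid_law_closure_le Theta n (A : set (n.-tuple (borel Omega))) (c : R) :
  tau_relatively_compact inds Theta -> measurable A ->
  (forall Q, Theta Q -> fine (iid_law Q n A) <= c) ->
  forall P, tau_closure inds Theta P -> fine (iid_law P n A) <= c.
Proof.
move=> cTheta mA Ac P CP.
pose C : set (Lambda R Omega) := tau_closure inds Theta.
pose F : set_system (Lambda R Omega) := within C (nbhs (P : tau_space inds)).
have FF : Filter F by exact: within_filter.
have FC : F C by exact: withinT.
have Fid : setwise_cvg F P id.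
  move=> B mB; apply: cvg_trans (@continuous_measure _ mB P).
  by apply: cvg_app; exact: cvg_within.
rewrite leNgt; apply/negP => cP.
have PA :=
  setwise_cvg_iid (n := n) FC CP (compact_equicontinuous cTheta) Fid mA.
have /CP[Q [TQ /= h]] : F [set Q | c < fine (iid_law Q n A)].
  exact: (cvgr_gt _ (PA FF) _ cP).
have := h (@subset_closure (tau_space inds) _ _ TQ).
by apply/negP; rewrite -leNgt; exact: Ac.
Qed.

Lemma measurable_unit_fun_ge d (T : measurableType d) (K : T -> R) (c : R) :
  unit_fun K -> measurable [set x | c <= K x].
Proof.
move=> [mK _]; rewrite -[X in measurable X]setTI.
rewrite (_ : [set x | _] = K @^-1` `[c, +oo[); first exact: mK.
by apply/seteqP; split => x /=; rewrite in_itv/= andbT.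
Qed.

Lemma unit_fun_markov d (T : measurableType d) (P : probability T R)
    (K : T -> R) :
  unit_fun K -> (P [set x | (1 / 2 <= K x)%R] <= 'E_P[K] + 'E_P[K])%E.
Proof.
move=> uK; have [mK K01] := uK; have K0 x : 0 <= K x by case/andP: (K01 x).
have mA := measurable_unit_fun_ge (1 / 2) uK.
rewrite -expectation_indic// -ge0_expectationD//; apply: le_expectation => //.
- exact: measurable_funD.
- move=> x; rewrite indicE.
  have [xA|xA] := pselect ([set x | (1 / 2 <= K x)%R] x).
    by rewrite mem_set//=; move: xA => /=; lra.
  by rewrite memNset//=; have := K0 x; lra.
Qed.

Lemma separable_disjoint Theta0 Theta1 :
  tau_relatively_compact inds Theta0 -> tau_relatively_compact inds Theta1 ->
  separable Theta0 Theta1 ->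
  tau_closure inds Theta0 `&` tau_closure inds Theta1 = set0.
Proof.
move=> cTheta0 cTheta1 [K uK cK]; apply/seteqP; split => // P [C0P C1P].
(* With errors at most 1 / 8 the events [1 / 2 <= K n x] and
   [1 / 2 <= 1 - K n x] both have mass at most 1 / 4 at [P], although they cover
   the space. *)
have [|n _ /(_ n (leqnn n))[K0 K1]] := cK (1 / 8); first by lra.
have mge (L : n.-tuple (borel Omega) -> R) (uL : unit_fun L) :=
  measurable_unit_fun_ge (1 / 2) uL.
have bound Theta (L : n.-tuple (borel Omega) -> R) : unit_fun L ->
    (forall Q, Theta Q -> ('E_(iid_law Q n)[L] <= (1 / 8)%:E)%E) ->
    forall Q, Theta Q -> fine (iid_law Q n [set x | 1 / 2 <= L x]) <= 1 / 4.
  move=> uL LQ Q TQ; rewrite -lee_fin fineK ?fin_num_measure//; last exact: mge.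
  apply: le_trans (unit_fun_markov _ uL) _.
  rewrite (_ : 1 / 4 = 1 / 8 + 1 / 8); last by lra.
  by rewrite EFinD leeD// LQ.
have uK' := unit_funC (uK n).
have := iid_law_closure_le cTheta0 (mge _ (uK n)) (bound _ _ (uK n) K0) C0P.
have := iid_law_closure_le cTheta1 (mge _ uK') (bound _ _ uK' K1) C1P.
set A := [set x | _]; set B := [set x | 1 / 2 <= K n x] => PA PB.
have mA : measurable A by exact: mge uK'.
have mB : measurable B by exact: mge (uK n).
have : (iid_law P n (A `|` B) <= iid_law P n A + iid_law P n B)%E.
  exact: measureU2.
rewrite (_ : A `|` B = setT); last first.
  apply/seteqP; split => // x _; rewrite /A /B /=.
  by case: (leP (1 / 2) (K n x)) => h; [right|left; lra].
rewrite probability_setT -(fineK (fin_num_measure _ _ mA)).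
rewrite -(fineK (fin_num_measure _ _ mB)) -EFinD lee_fin; lra.
Qed.

End tau_compactness.

(** * Distinguishability and disjoint closures *)

Theorem theorem4p1 (R : realType) (Omega : ptopologicalType)
    (Theta0 Theta1 : set (Lambda R Omega)) :
  (forall Psi : set (Omega -> R),
     Psi = bounded_continuous R Omega \/
     Psi = borel_indicators R Omega \/
     Psi = bounded_borel R Omega ->
     tau_relatively_compact Psi Theta0 ->
     tau_closure Psi Theta0 `&` tau_closure Psi Theta1 = set0 ->
     distinguishable Theta0 Theta1) /\
  (tau_relatively_compact (borel_indicators R Omega) Theta0 ->
   tau_relatively_compact (borel_indicators R Omega) Theta1 ->
   distinguishable Theta0 Theta1 ->
   tau_closure (borel_indicators R Omega) Theta0 `&`
     tau_closure (borel_indicators R Omega) Theta1 = set0).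
Proof.
split=> [Psi Psi3 cTheta0 disj|cTheta0 cTheta1 dist].
  apply/distinguishableE; apply: separable_closure cTheta0 disj.
  case: Psi3 => [->|[->|->]] //; first exact: bounded_continuous_borel.
  exact: borel_indicators_borel.
exact/separable_disjoint/distinguishableE.
Qed.
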